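(* Let $\pi=\pi_1\pi_2\cdots\pi_n$ be a left-crucial permutation with respect to squares such that either $\pi_1<\pi_2<\pi_3$ or $\pi_1>\pi_2>\pi_3$. Then $n\geq 31$.
   Context: Permutations are written in one-line notation. A factor is a sequence of consecutive entries; two sequences of distinct numbers of equal length are order-isomorphic if their entries are in the same relative order. A square is a factor $XY$ with $X,Y$ consecutive, of equal length at least $2$, and order-isomorphic; its length is $2|X|$. A permutation is square-free if it contains no square. For $\pi=\pi_1\cdots\pi_n$ and $x\in\{1,\dots,n+1\}$, the extension of $\pi$ to the left by $x$ is the permutation $x\pi'_1\cdots\pi'_n$ where $\pi'_j=\pi_j$ if $\pi_j<x$ and $\pi'_j=\pi_j+1$ otherwise. A permutation is left-crucial with respect to squares if it is square-free but every extension of it to the left by every $x\in\{1,\dots,n+1\}$ contains a square. *)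

(* Defs.v *)
From mathcomp Require Import all_boot.

Set Implicit Arguments.
Unset Strict Implicit.
Unset Printing Implicit Defensive.

(* A permutation of {1, ..., n} is its one-line notation, so the entry pi_i
   is nth 0 p i.-1. *)
Definition is_permutation (n : nat) (p : seq nat) : Prop :=
  perm_eq p (iota 1 n).

Definition order_isomorphic (X Y : seq nat) : Prop :=
  size X = size Y /\
  forall i j : nat, i < size X -> j < size X ->
    (nth 0 X i < nth 0 X j) = (nth 0 Y i < nth 0 Y j).

Definition is_square (Z : seq nat) : Prop :=
  exists X Y : seq nat,
    [/\ Z = X ++ Y, 2 <= size X & order_isomorphic X Y].

Definition contains_square (p : seq nat) : Prop :=
  exists Z : seq nat, infix Z p /\ is_square Z.

Definition square_free (p : seq nat) : Prop := ~ contains_square p.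

Definition left_extension (x : nat) (p : seq nat) : seq nat :=
  x :: [seq if y < x then y else y.+1 | y <- p].

Definition left_crucial (n : nat) (p : seq nat) : Prop :=
  [/\ is_permutation n p,
      square_free p &
      forall x : nat, 1 <= x <= n.+1 -> contains_square (left_extension x p)].

(* Main.v *)
Require Import Defs.
From mathcomp Require Import all_boot.
From mathcomp Require Import zify.

(* Take pi_1 < pi_2 < pi_3 (the other case is obtained by reversing the order)
   and suppose n <= 30.  Having no square of length 4 forces the ascents and
   descents of pi to have period 4, and they still do in an extension by some
   x > pi_1; so the square created by x, which is a prefix, has a half-length
   k divisible by 4, that is k = 4, 8 or 12.  There pi_k is placed with respect
   to pi_(k+2) and pi_(k+3) as x is with respect to pi_2 and pi_3.  Choosing x
   between pi_1 and pi_2, between pi_2 and pi_3, and above pi_3 thus yields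
   three different values of k, so all of 4, 8 and 12 occur.  But the square
   with k = 8 makes (pi_4, pi_6, pi_7) and (pi_12, pi_14, pi_15)
   order-isomorphic, so k = 4 and k = 12 come from the same position of x. *)

Lemma contains_squareP (w : seq nat) :
  contains_square w <->
  exists i k, [/\ 2 <= k, i + k + k <= size w &
    forall a c, a < k -> c < k ->
      (nth 0 w (i + a) < nth 0 w (i + c)) =
      (nth 0 w (i + k + a) < nth 0 w (i + k + c))].
Proof.
split.
- case=> Z [/infixP [s1 [s3 ->]]] [X [Y [-> le2X [eqXY isoXY]]]].
  exists (size s1), (size X); split => //.
    by rewrite !size_cat -eqXY !addnA leq_addr.
  have nthX a : a < size X -> nth 0 (s1 ++ (X ++ Y) ++ s3) (size s1 + a) = nth 0 X a.
    move=> ltaX; rewrite nth_cat ltnNge leq_addr /= addKn -catA nth_cat.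
    by rewrite ltaX.
  have nthY a : a < size X ->
      nth 0 (s1 ++ (X ++ Y) ++ s3) (size s1 + size X + a) = nth 0 Y a.
    move=> ltaX; rewrite -addnA nth_cat ltnNge leq_addr /= addKn -catA nth_cat.
    by rewrite ltnNge leq_addr /= addKn nth_cat -eqXY ltaX.
  by move=> a c lta ltc; rewrite !nthX // !nthY //; apply: isoXY.
- case=> i [k [le2k lew isok]].
  have szX : size (take k (drop i w)) = k.
    by rewrite size_takel // size_drop; lia.
  have szY : size (take k (drop (i + k) w)) = k.
    by rewrite size_takel // size_drop; lia.
  exists (take k (drop i w) ++ take k (drop (i + k) w)); split.
    rewrite addnC -drop_drop -takeD; apply/infixP.
    exists (take i w), (drop (k + k) (drop i w)).
    by rewrite !cat_take_drop.
  exists (take k (drop i w)), (take k (drop (i + k) w)); split; rewrite ?szX //.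
  split; rewrite szX ?szY // => a c lta ltc.
  by rewrite !nth_take // !nth_drop; apply: isok.
Qed.

(** The flag [b] lets one argument serve both the increasing and the decreasing start. *)
Definition precedes (b : bool) (x y : nat) : bool := if b then x < y else y < x.

Lemma precedes_asym b x y : x != y -> precedes b y x = ~~ precedes b x y.
Proof. by rewrite /precedes; case: b; lia. Qed.

Lemma left_extension_nth b x p i j : i < size p -> j < size p ->
  precedes b (nth 0 (left_extension x p) i.+1) (nth 0 (left_extension x p) j.+1) =
  precedes b (nth 0 p i) (nth 0 p j).
Proof.
by move=> lti ltj; rewrite /= !(nth_map 0) // /precedes; case: b; do 2 case: ifP; lia.
Qed.

Lemma nth_neq (p : seq nat) i j : uniq p -> i < size p -> j < size p -> i != j ->
  nth 0 p i != nth 0 p j.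
Proof. by move=> uniq_p lti ltj; rewrite nth_uniq. Qed.

Section ExtensionSquare.

Variables (b : bool) (p : seq nat).
Hypotheses (uniq_p : uniq p) (sqf_p : square_free p).

Local Notation lt i j := (precedes b (nth 0 p i) (nth 0 p j)).

(** Otherwise the entries at [i], ..., [i.+3] form a square with halves of length 2. *)
Lemma ascent_alternates i : i + 3 < size p -> lt i.+2 i.+3 = ~~ lt i i.+1.
Proof.
move=> lti; case: (altP (lt i.+2 i.+3 =P ~~ lt i i.+1)) => // same.
case: sqf_p; apply/contains_squareP; exists i, 2; split=> // [|a c]; first by lia.
have neq1 : nth 0 p i != nth 0 p i.+1 by apply: nth_neq => //; lia.
have neq2 : nth 0 p i.+2 != nth 0 p i.+3 by apply: nth_neq => //; lia.
move: same neq1 neq2; rewrite /precedes.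
case: a c => [|[|a]] // [|[|c]] //.
all: rewrite ?addn0 ?addn1 ?addn2 ?ltnn //.
all: case: (b).
all: lia.
Qed.

Hypotheses (le3p : 3 <= size p) (lt01 : lt 0 1) (lt12 : lt 1 2).

Variable x : nat.
Local Notation e := (left_extension x p).
Local Notation lte i j := (precedes b (nth 0 e i) (nth 0 e j)).
Hypothesis x_above : lte 1 0.

(** The steps [lt01] and [lt12] fix all later ones by alternation inside [p]; the step from [x],
    reversed by [x_above], fits the same period. *)
Lemma extension_ascent j : j < size p -> lte j j.+1 = (j %% 4 \in [:: 1; 2]).
Proof.
elim/ltn_ind: j => -[|[|[|j]]] IH ltj.
- have neq : nth 0 e 1 != nth 0 e 0.
    by apply: contraTneq x_above => ->; rewrite /precedes ltnn; case: (b).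
  by rewrite precedes_asym // x_above.
- by rewrite left_extension_nth // ?lt01 //; lia.
- by rewrite left_extension_nth // ?lt12 //; lia.
- rewrite left_extension_nth ?ascent_alternates; try lia.
  rewrite -(@left_extension_nth b x) ?IH; try lia.
  by rewrite !inE; lia.
Qed.

Lemma extension_square : contains_square e ->
  exists k, [/\ 4 %| k, 0 < k, k + k <= (size p).+1 &
    forall i j, i < k -> j < k -> lte i j = lte (k + i) (k + j)].
Proof.
case/contains_squareP => -[|i] [k [le2k lek iso]]; last first.
  (* A square that does not start at [x] already lies in [p]. *)
  case: sqf_p; apply/contains_squareP; exists i, k; split=> // [|a c lta ltc].
    by move: lek; rewrite /= size_map; lia.
  have := iso a c lta ltc; move: lek; rewrite !addSn [size _]/= size_map => lek.
  have := @left_extension_nth true x p; rewrite {1 2}/precedes => E.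
  by rewrite !E //; lia.
have {}iso i j : i < k -> j < k -> lte i j = lte (k + i) (k + j).
  by move=> lti ltj; rewrite /precedes; case: (b); apply: iso.
have {}lek : k + k <= (size p).+1 by move: lek; rewrite /= size_map.
exists k; split=> //; last by lia.
(* Comparing step 0 with step [k] leaves [k] equal to 0 or 3 modulo 4, which excludes [k = 2]. For
   larger [k], step 1 lies inside the first half and leaves 0 or 1. *)
have := iso 0 1; rewrite addn0 addn1 !extension_ascent ?inE; try lia.
have [->|] := eqVneq k 2; first by move=> /(_ isT isT).
have := iso 1 2; rewrite addn1 addn2 => + + .
case: (ltnP 2 k) => [lt2k|]; last by lia.
by rewrite !extension_ascent ?inE; lia.
Qed.

(** Index [i] of [p] is index [i.+1] of the extension, so the second clause compares indices 0, 2, 3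
    of the square with their images. The third uses indices 4, 6, 7 when [k = 8]; its two sides have
    the form of the second clause for 4 and 12. *)
Lemma extension_slot : size p <= 30 -> contains_square e ->
  exists k, [/\ k \in [:: 4; 8; 12],
    (lt k.-1 k.+1, lt k.-1 k.+2) = (lte 0 2, lte 0 3) &
    k = 8 -> (lt 3 5, lt 3 6) = (lt 11 13, lt 11 14)].
Proof.
move=> le30p /extension_square [k [dvd4k lt0k lek iso]].
have le4k : 4 <= k by apply: dvdn_leq.
exists k; split.
(* Here [k + k <= 31], so 16 is out of reach. *)
- by rewrite !inE; lia.
- rewrite iso ?(iso 0 3); try lia.
  case: k le4k lek {dvd4k lt0k iso} => // k le4k lek.
  by rewrite addn0 addn2 addn3 !left_extension_nth //; lia.
- move=> k8; move: lek iso; rewrite {}k8 => lek iso.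
  have := iso 4 6 isT isT; have := iso 4 7 isT isT.
  by rewrite !left_extension_nth; try lia; move=> -> ->.
Qed.

End ExtensionSquare.

Theorem theorem4 (n : nat) (p : seq nat)
  (hn : 3 <= n)
  (hp : left_crucial n p)
  (h123 : (nth 0 p 0 < nth 0 p 1 /\ nth 0 p 1 < nth 0 p 2) \/
          (nth 0 p 0 > nth 0 p 1 /\ nth 0 p 1 > nth 0 p 2)) :
  31 <= n.
Proof.
have [perm_p sqf_p crucial_p] := hp.
have uniq_p : uniq p by rewrite (perm_uniq perm_p) iota_uniq.
have size_p : size p = n by rewrite (perm_size perm_p) size_iota.
have entry i : i < 3 -> 1 <= nth 0 p i <= n.
  move=> lti; have : nth 0 p i \in p by rewrite mem_nth // size_p; lia.
  by rewrite (perm_mem perm_p) mem_iota; lia.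
have [[e0 e1] e2] := (entry 0 isT, entry 1 isT, entry 2 isT).
have [|le30n] := ltnP 30 n; first by [].
have [b [lt01 lt12]] : exists b,
    precedes b (nth 0 p 0) (nth 0 p 1) /\ precedes b (nth 0 p 1) (nth 0 p 2).
  by case: h123; [exists true | exists false].
pose place k := (precedes b (nth 0 p k.-1) (nth 0 p k.+1),
                 precedes b (nth 0 p k.-1) (nth 0 p k.+2)).
(* A tie puts [x] below the entry, since the extension raises every entry that is at least [x]. *)
pose before x i := if b then x <= nth 0 p i else nth 0 p i < x.
have slot x s : [/\ 1 <= x <= n.+1, ~~ before x 0 & (before x 1, before x 2) = s] ->
    exists k, [/\ k \in [:: 4; 8; 12], place k = s & k = 8 -> place 4 = place 12].
  case=> ltx Nbefore0 <-.
  have nth_ext i : i < 3 -> nth 0 (left_extension x p) i.+1 =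
      if nth 0 p i < x then nth 0 p i else (nth 0 p i).+1.
    by move=> lti; rewrite /= (nth_map 0) // size_p (leq_trans lti).
  have beforeE i : i < 3 -> before x i = precedes b (nth 0 (left_extension x p) 0)
                                                  (nth 0 (left_extension x p) i.+1).
    by move=> /nth_ext ->; rewrite /before /precedes /=; case: (b); case: ifP; lia.
  rewrite !beforeE //; apply: extension_slot; rewrite ?size_p //; last exact: crucial_p.
  by move: Nbefore0; rewrite nth_ext // /before /precedes /=; case: (b); case: ifP; lia.
move: lt01 lt12; rewrite /precedes => lt01 lt12.
(* In the order given by b, the three x lie just before pi_2, just before pi_3,
   and after every entry. *)
have [|k1 [in1 place1 eight1]] := slot (nth 0 p 1 + ~~ b) (true, true).
  by rewrite /before; split; last congr pair; case: (b) lt01 lt12 => /=; lia.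
have [|k2 [in2 place2 eight2]] := slot (nth 0 p 2 + ~~ b) (false, true).
  by rewrite /before; split; last congr pair; case: (b) lt01 lt12 => /=; lia.
have [|k3 [in3 place3 eight3]] := slot (if b then n.+1 else 1) (false, false).
  by rewrite /before; split; last congr pair; case: (b) lt01 lt12 => /=; lia.
move: in1 in2 in3 place1 place2 place3 eight1 eight2 eight3.
(* Two equal half-lengths would give one [place] two values; if all three differ, one is 8 and
   forces [place 4 = place 12]. *)
rewrite !inE => /or3P [] /eqP -> /or3P [] /eqP -> /or3P [] /eqP ->; clear.
all: by move=> ? ? ? h1 h2 h3;
  first [congruence | have := h1 erefl; congruence
        | have := h2 erefl; congruence | have := h3 erefl; congruence].
Qed.
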